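(* Let $G$ be a finite group, $F$ a subgroup of $G$, $\mathcal{C}$ the conjugacy class of $F$ in $G$ (the set of all subgroups of $G$ conjugate to $F$), and $d$ a positive divisor of the index $[G:F]$. Then $$\sum_{H\in\mathcal{C}}\ \sum_{\substack{H\leq K\leq G\\ [K:H]\mid d}}\mu_{G}(H,K)\equiv 0 \pmod d .$$
   Context: For a finite group $G$, $\mathcal{L}(G)$ denotes the set of all subgroups of $G$, partially ordered by inclusion (written $\leq$). $\mu_G$ is the integer-valued Möbius function of this finite poset: $\mu_G(H,H)=1$ for all $H$, $\mu_G(H,K)=-\sum_{H\leq L<K}\mu_G(H,L)$ for $H<K$, and $\mu_G(H,K)=0$ if $H\not\leq K$. *)

(* Defs.v *)
From mathcomp Require Import all_boot all_order all_algebra all_fingroup.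

Set Implicit Arguments.
Unset Strict Implicit.
Unset Printing Implicit Defensive.

Import GRing.Theory.

Local Open Scope ring_scope.

Section SubgroupMoebius.

Variables (gT : finGroupType) (G : {group gT}).
Implicit Types H K L : {group gT}.

(* [n] is recursion fuel; [#|K|] steps always suffice, because the recursive
   calls are on proper subgroups of [K]. *)
Fixpoint subgroup_moebius_rec (n : nat) H K : int :=
  if n is n'.+1 then
    if H == K then 1
    else if H \subset K then
      - \sum_(L in subgroups G | (H \subset L) && (L \proper K))
          subgroup_moebius_rec n' H L
    else 0
  else 0.

Definition subgroup_moebius H K : int := subgroup_moebius_rec #|K| H K.

Lemma subgroup_moebius_recE n H K :
  (#|K| <= n)%N -> subgroup_moebius_rec n H K = subgroup_moebius H K.
Proof.
suff rec m n' K' : (#|K'| <= m)%N -> (#|K'| <= n')%N ->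
    subgroup_moebius_rec m H K' = subgroup_moebius_rec n' H K'.
  by move=> leKn; apply: rec.
elim: m n' K' => [|m IHm] [|n'] K'; rewrite ?leqn0 ?(gtn_eqF (cardG_gt0 K')) //.
move=> leKm leKn /=; case: eqP => // _; case: ifP => // _; congr (- _).
apply: eq_bigr => L /and3P[_ _ /proper_card ltLK].
by apply: IHm; rewrite -ltnS; apply: leq_trans ltLK _.
Qed.

Lemma subgroup_moebius_refl H : subgroup_moebius H H = 1.
Proof.
by rewrite /subgroup_moebius; case: #|H| (cardG_gt0 H) => //= n _; rewrite eqxx.
Qed.

Lemma subgroup_moebius_proper H K : H \proper K ->
  subgroup_moebius H K =
    - \sum_(L in subgroups G | (H \subset L) && (L \proper K))
        subgroup_moebius H L.
Proof.
move=> prHK; rewrite -(@subgroup_moebius_recE #|K|.+1) //=.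
case: eqP => [eqHK|_]; first by rewrite eqHK properxx in prHK.
rewrite (proper_sub prHK); congr (- _).
apply: eq_bigr => L /and3P[_ _ /proper_card/ltnW].
exact: subgroup_moebius_recE.
Qed.

Lemma subgroup_moebius_eq0 H K : ~~ (H \subset K) -> subgroup_moebius H K = 0.
Proof.
rewrite /subgroup_moebius; case: #|K| => //= n; case: eqP => [->|_].
  by rewrite subxx.
by move/negPf->.
Qed.

End SubgroupMoebius.

(* Main.v *)
(** Let N = |G| and n = d |F|, so that [K : H] | d iff |K| | n for H in the class
    of F.  Let G act by right translation on its n-subsets, as in Wielandt's proof
    of Sylow's theorem: a subgroup K of order k fixes w_n(k) of them, where
    w_n(k) = C(N/k, n/k) if k | n and 0 otherwise.  Moebius inversion turns
    sum_H sum_K mu(H, K) w_n(|K|) into the number of n-subsets whose stabilizer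
    is conjugate to F, a multiple of [G : F].  Comparing with a cyclic group of
    order N, w_n is an integral combination of the functions
    v_j(k) = (N/j) [k | j], j | n, in which v_n has coefficient 1.  By induction
    on n, [G : F] divides sum_H sum_K mu(H, K) v_n(|K|), that is, N/n times the
    sum in the theorem; and [G : F] = (N/n) d. *)

Require Import Defs.
From mathcomp Require Import all_boot all_order all_algebra all_fingroup.
From mathcomp Require Import cyclic.

Set Implicit Arguments.
Unset Strict Implicit.
Unset Printing Implicit Defensive.

Import GRing.Theory.

Local Open Scope ring_scope.

Lemma dvdn_card_acts (aT : finGroupType) (rT : finType)
    (to : {action aT &-> rT}) (G : {group aT}) (S : {set rT}) m :
  [acts G, on S | to] -> {in S, forall x, #|orbit to G x| = m} ->
  (m %| #|S|)%N.
Proof.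
move=> actsG orbS.
rewrite (@card_uniform_partition _ m _ _ _ (orbit_partition actsG)) ?dvdn_mull //.
by move=> _ /imsetP[x Sx ->]; apply: orbS.
Qed.

Section TranslatedSubsets.

Variables (gT : finGroupType) (G : {group gT}) (n : nat).
Local Open Scope group_scope.

Definition draws := [set A : {set gT} | (A \subset G) && (#|A| == n)].

Lemma card_orbitR (K : {group gT}) x : #|orbit 'R K x| = #|K|.
Proof. by rewrite orbitR card_lcoset. Qed.

(** The orbits of [K] on [A] are left cosets of [K], so all have [#|K|] elements. *)
Lemma astab1_draw_dvdn (K : {group gT}) (A : {set gT}) :
  K \subset 'C[A | 'R^*] -> (#|K| %| #|A|)%N.
Proof.
rewrite astab1_set => actsK; apply: dvdn_card_acts actsK _ => x _.
exact: card_orbitR.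
Qed.

Lemma acts_draws : [acts G, on draws | 'R^*].
Proof.
apply/subsetP=> a Ga; rewrite !inE; apply/subsetP=> A.
rewrite !inE card_setact => /andP[sAG ->]; rewrite andbT.
by apply/subsetP=> _ /imsetP[x Ax ->]; rewrite groupM // (subsetP sAG).
Qed.

(** A subset of [G] fixed by [K] is a union of left cosets of [K]: choosing it means choosing
    [n %/ #|K|] of the [#|G| %/ #|K|] cosets in [G]. *)
Lemma card_fixed_draws (K : {group gT}) : K \subset G ->
  #|[set A in draws | K \subset 'C[A | 'R^*]]|
    = (if #|K| %| n then 'C(#|G| %/ #|K|, n %/ #|K|) else 0)%N.
Proof.
move=> sKG; case: ifP => [dvKn | ndvKn]; last first.
  apply: eq_card0 => A; rewrite !inE; apply/negP=> /andP[/andP[_ /eqP cardA]].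
  by move/astab1_draw_dvdn; rewrite cardA ndvKn.
have actsKG : [acts K, on G | 'R].
  apply/actsP=> a Ka x /=; rewrite groupMr //; exact: subsetP Ka.
pose f (A : {set gT}) := orbit 'R K @: A.
have part (A : {set gT}) : K \subset 'C[A | 'R^*] -> partition (f A) A.
  by rewrite astab1_set; apply: orbit_partition.
have card_f (A : {set gT}) : K \subset 'C[A | 'R^*] -> (#|f A| * #|K|)%N = #|A|.
  move=> fixA; rewrite (@card_uniform_partition _ #|K| (f A)  A) //; last exact: part.
  by move=> _ /imsetP[x _ ->]; apply: card_orbitR.
have card_fG : #|f G| = (#|G| %/ #|K|)%N.
  by rewrite -(card_f G) ?mulnK // astab1_set.
rewrite -card_fG -cards_draws -(@card_in_imset _ _ f); last first.
  move=> A B; rewrite !inE => /andP[_ /part/cover_partition defA].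
  by case/andP=> _ /part/cover_partition defB eqf; rewrite -defA eqf.
apply: eq_card => Q; rewrite inE; apply/imsetP/andP => [[A]|[sQ /eqP cardQ]].
  rewrite !inE => /andP[/andP[sAG /eqP <-] fixA] ->.
  by rewrite imsetS // -(card_f A) ?mulnK.
(* Surjectivity of [f]: as distinct orbits are disjoint, a set [Q] of orbits can be read off from
   its union. *)
have memQ x : (x \in cover Q) = (x \in G) && (orbit 'R K x \in Q).
  apply/bigcupP/andP=> [[B QB Bx]|[Gx Qx]]; last first.
    by exists (orbit 'R K x) => //; apply: orbit_refl.
  have /imsetP[y Gy defB] := subsetP sQ B QB.
  have eqxy : orbit 'R K x = orbit 'R K y by apply/orbit_eqP; rewrite -defB.
  rewrite eqxy -defB; split=> //.
  have: x \in orbit 'R K y by rewrite -defB.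
  by case/orbitP=> a Ka <-; rewrite (actsP actsKG).
have fixQ : K \subset 'C[cover Q | 'R^*].
  rewrite astab1_set; apply/actsP=> a Ka x; rewrite !memQ (actsP actsKG) //.
  by congr (_ && (_ \in Q)); apply/orbit_eqP; rewrite mem_orbit.
have defQ : Q = f (cover Q).
  apply/setP=> B; apply/idP/imsetP=> [QB|[x]]; last first.
    by rewrite memQ => /andP[_ Qx] ->.
  have /imsetP[y Gy defB] := subsetP sQ B QB.
  by exists y; rewrite // memQ Gy -defB.
exists (cover Q); rewrite // !inE fixQ andbT -(card_f _ fixQ) -defQ cardQ.
rewrite divnK // eqxx andbT.
by apply/subsetP=> x; rewrite memQ => /andP[].
Qed.

End TranslatedSubsets.

Lemma astab1_act_group (aT : finGroupType) (rT : finType)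
    (to : {action aT &-> rT}) (G : {group aT}) x a :
  a \in G -> 'C_G[to x a | to]%G = ('C_G[x | to] :^ a)%G.
Proof. by move=> Ga; apply: group_inj; rewrite /= astab1_act [RHS]conjIg conjGid. Qed.

(* The action of a cyclic group of order [N] on its [n]-subsets: there [K] fixes
   [A] iff [#|K|] divides the order of the stabilizer of [A], and the subsets
   with a stabilizer of order [j] form orbits of length [N %/ j]. *)
Lemma fixed_draws_decomposition (N n : nat) : (0 < N)%N -> (n %| N)%N ->
  exists a : nat -> nat, forall k, (k %| N)%N ->
    (if k %| n then 'C(N %/ k, n %/ k) else 0)%N
      = (\sum_(j < n.+1 | (j %| n) && (k %| j)) a j * (N %/ j))%N.
Proof.
case: N => // N _ dvnN; have n_gt0 := dvdn_gt0 (ltn0Sn N) dvnN.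
(* The group law on ['I_N.+1] is addition modulo [N.+1]. *)
pose G : {group 'I_N.+1} := [set: 'I_N.+1]%G.
pose st (A : {set 'I_N.+1}) := 'C_G[A | 'R^*]%G.
have cardG : #|G| = N.+1 by rewrite cardsT card_ord.
have cycG : cyclic G by apply/cyclicP; exists Zp1; apply: Zp_cycle.
pose S j := [set A in draws G n | #|st A| == j].
have dvS j : (N.+1 %/ j %| #|S j|)%N.
  apply: (@dvdn_card_acts _ _ 'R^*%act G).
    apply/subsetP=> a Ga; rewrite !inE; apply/subsetP=> A.
    rewrite [A \in S j]inE => /andP[nA stA].
    have nAa : 'R^*%act A a \in draws G n by rewrite (actsP (acts_draws G n)).
    have stAa : #|st ('R^*%act A a)| == j by rewrite /st astab1_act_group // cardJg.
    have SAa : 'R^*%act A a \in S j by rewrite inE nAa.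
    by rewrite inE; exact: SAa.
  move=> A; rewrite !inE => /andP[_ /eqP cardA].
  by rewrite -cardA -cardG -(card_orbit_stab 'R^* G A) mulnK.
(* The coefficient at [j] is the number of orbits on the subsets with stabilizer of order [j]. *)
exists (fun j => #|S j| %/ (N.+1 %/ j))%N => k dvkN.
have [K sKG ordK] : exists2 K : {group 'I_N.+1}, K \subset G & #|K| = k.
  exists <[Zp1 ^+ (N.+1 %/ k)]>%G; first exact: subsetT.
  by rewrite -orderE orderXdiv order_Zp1 ?dvdn_div // divnA // mulKn.
have := card_fixed_draws n sKG; rewrite ordK cardG => <-.
rewrite -sum1_card.
(* The default value of [inord] never occurs on [draws G n], where stabilizer orders divide [n]. *)
pose j0 A : 'I_n.+1 := inord #|st A|.
have st_dvd A : A \in draws G n -> (#|st A| %| n)%N.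
  rewrite inE => /andP[_ /eqP <-]; apply: astab1_draw_dvdn; exact: subsetIr.
have val_j0 A : A \in draws G n -> j0 A = #|st A| :> nat.
  by move/st_dvd/(dvdn_leq n_gt0) => le_n; rewrite inordK.
have fixE A : (K \subset 'C[A | 'R^*]%g) = (k %| #|st A|)%N.
  by rewrite -ordK (cardSg_cyclic cycG) ?subsetIl // [RHS]subsetI sKG.
rewrite (partition_big j0 (fun j => (j %| n) && (k %| j))%N) /=; last first.
  move=> A; rewrite inE fixE => /andP[nA kA].
  by rewrite val_j0 // st_dvd.
apply: eq_bigr => j /andP[_ dvkj]; rewrite divnK // -sum1_card.
apply: eq_bigl => A; rewrite inE [RHS]inE fixE -andbA.
have [nA|//] := boolP (A \in draws G n); rewrite -val_eqE /= val_j0 //.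
by case: eqP => [->|]; rewrite ?dvkj ?andbF.
Qed.

(** For [H] proper in [L], the recursion makes the term at [L] cancel all the others. *)
Lemma sum_moebius_interval (gT : finGroupType) (G H L : {group gT}) :
  H \subset L -> L \subset G ->
  \sum_(K in subgroups G | (H \subset K) && (K \subset L))
     subgroup_moebius G H K = (H == L)%:R.
Proof.
case: eqVneq => [<- _ sHG | neqHL sHL sLG].
  rewrite (big_pred1 H) ?subgroup_moebius_refl // => K.
  rewrite inE; apply/and3P/eqP=> [[_ sHK sKH]|->]; last by rewrite sHG subxx.
  by apply/group_inj/eqP; rewrite eqEsubset sKH.
have prHL : H \proper L.
  by rewrite properEneq sHL andbT; apply: contraNneq neqHL => /group_inj->.
rewrite (bigD1 L) /= ?inE ?sHL ?subxx ?sLG //.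
rewrite (subgroup_moebius_proper G prHL) addrC; apply/eqP.
rewrite subr_eq0; apply/eqP/eq_bigl => K; rewrite -!andbA; congr [&& _, _ & _].
by rewrite properEneq andbC.
Qed.

(** After exchanging the sums, each [x] contributes the Moebius sum over the interval from [H] to
    its stabilizer, which vanishes unless the two are equal. *)
Lemma sum_moebius_fixed (aT : finGroupType) (rT : finType)
    (to : {action aT &-> rT}) (G H : {group aT}) (S : {set rT}) :
  H \subset G ->
  \sum_(K in subgroups G | H \subset K)
     subgroup_moebius G H K * (#|[set x in S | K \subset 'C[x | to]%g]|%:R)
  = #|[set x in S | 'C_G[x | to]%G == H]|%:R.
Proof.
move=> sHG.
under eq_bigr => K _ do rewrite -sum1dep_card natr_sum big_distrr /=.
rewrite (exchange_big_dep (mem S)) => [|K x _ /andP[]//] /=.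
rewrite -sum1dep_card natr_sum big_mkcondr /=; apply: eq_bigr => x Sx.
have [sHx | nsHx] := boolP (H \subset 'C_G[x | to]%G); last first.
  rewrite big_pred0 => [|K]; first by case: eqP nsHx => // ->; rewrite subxx.
  rewrite inE Sx; apply: contraNF nsHx => /andP[/andP[sKG sHK] sKx].
  by rewrite subsetI sHG (subset_trans sHK).
rewrite (_ : (if _ then _ else _)%R = (H == 'C_G[x | to]%G)%:R); last first.
  by rewrite eq_sym; case: eqP.
rewrite -(sum_moebius_interval sHx (subsetIl _ _)).
apply: eq_big => K; rewrite ?mulr1 //.
by rewrite inE Sx [in RHS]subsetI; case: (K \subset G).
Qed.

(** The double sum counts the points of [S] with stabilizer conjugate to [F]; they form orbits of
    length [#|G : F|]. *)
Lemma dvdz_sum_moebius_fixed (aT : finGroupType) (rT : finType)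
    (to : {action aT &-> rT}) (G F : {group aT}) (S : {set rT}) :
  F \subset G -> [acts G, on S | to] ->
  (#|G : F|%g %| \sum_(H in orbit 'JG%act G F)
     \sum_(K in subgroups G | H \subset K)
       subgroup_moebius G H K * (#|[set x in S | K \subset 'C[x | to]%g]|%:R))%Z.
Proof.
move=> sFG actsS.
have sCG H : H \in orbit 'JG%act G F -> H \subset G.
  by case/orbitP=> a Ga <-; rewrite /= -(conjGid Ga) conjSg.
under eq_bigr => H C_H do rewrite sum_moebius_fixed ?sCG //.
rewrite -natr_sum natz.
pose T := [set x in S | 'C_G[x | to]%G \in orbit 'JG%act G F].
have -> : (\sum_(H in orbit 'JG%act G F)
             #|[set x in S | 'C_G[x | to]%G == H]|)%N = #|T|.
  rewrite -sum1dep_card.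
  rewrite (partition_big (fun x => 'C_G[x | to]%G) (mem (orbit 'JG%act G F))) /=.
    apply: eq_bigr => H C_H; rewrite -sum1dep_card; apply: eq_bigl => x.
    by case: eqP => [->|]; rewrite ?C_H ?andbF ?andbT.
  by move=> x /andP[].
apply: (@dvdn_card_acts _ _ to G).
  apply/subsetP=> a Ga; rewrite !inE; apply/subsetP=> x; rewrite !inE.
  rewrite (actsP actsS) // => /andP[-> Cx]; rewrite astab1_act_group //=.
  exact: orbit_trans (mem_orbit 'JG%act _ Ga) Cx.
move=> x; rewrite inE => /andP[_ /orbitP[a Ga defF]].
rewrite card_orbit -!divgS ?subsetIl //.
by have /(congr1 val)/= <- := defF; rewrite cardJg.
Qed.

Theorem theorem5p1 (gT : finGroupType) (G F : {group gT}) (d : nat)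
    (sFG : F \subset G) (d_gt0 : (0 < d)%N) (dvd_d : (d %| #|G : F|%g)%N) :
  (\sum_(H in orbit 'JG%act G F)
     \sum_(K in subgroups G | (H \subset K) && (#|K : H|%g %| d)%N)
        subgroup_moebius G H K
   = 0 %[mod d])%Z.
Proof.
pose U n : int := \sum_(H in orbit 'JG%act G F) \sum_(K in subgroups G | H \subset K)
  subgroup_moebius G H K * (#|K| %| n)%N%:R.
have dvdU n : (n %| #|G|)%N -> (#|G : F|%g %| (#|G| %/ n)%N%:Z * U n)%Z.
  elim/ltn_ind: n => n IHn dvnG.
  have n_gt0 := dvdn_gt0 (cardG_gt0 G) dvnG.
  have [a def_a] := fixed_draws_decomposition (cardG_gt0 G) dvnG.
  (* At [k = n] only [j = n] survives in [def_a], and the binomial there is C(N/n, 1) = N/n. *)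
  have a_n : (a n * (#|G| %/ n) = #|G| %/ n)%N.
    have := def_a n dvnG; rewrite dvdnn divnn n_gt0 bin1 => {2}->.
    by rewrite (big_pred1 ord_max) // => j; rewrite /= -val_eqE eqn_dvd.
  have := dvdz_sum_moebius_fixed sFG (acts_draws G n).
  rewrite [X in (_ %| X)%Z](_ : _ =
    \sum_(j < n.+1 | (j %| n)%N) (a j)%:Z * ((#|G| %/ j)%N%:Z * U j)).
    (* The last index [j = n] gives the wanted term; the smaller divisors fall to the induction
       hypothesis. *)
    rewrite big_mkcond big_ord_recr /= dvdnn mulrA -PoszM a_n.
    rewrite GRing.rpredDl //; apply: GRing.rpred_sum => j _.
    case: ifP => [dvjn|_]; last exact: dvdz0.
    by rewrite dvdz_mull // IHn // (dvdn_trans dvjn).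
  transitivity (\sum_(j < n.+1 | (j %| n)%N) \sum_(H in orbit 'JG%act G F)
    \sum_(K in subgroups G | H \subset K)
      subgroup_moebius G H K * (a j * (#|G| %/ j) * (#|K| %| j))%N%:R); last first.
    apply: eq_bigr => j _; rewrite !big_distrr /=; apply: eq_bigr => H _.
    rewrite !big_distrr /=; apply: eq_bigr => K _.
    by rewrite !natrM -!natz mulrCA !mulrA mulrAC.
  rewrite [RHS]exchange_big; apply: eq_bigr => H _.
  rewrite [RHS]exchange_big; apply: eq_bigr => K /andP[/[!inE] sKG _] /=.
  rewrite card_fixed_draws // def_a ?cardSg // -big_distrr -natr_sum /=.
  rewrite big_mkcondr; congr (_ * _%:R); apply: eq_bigr => j _.
  by case: ifP => _; rewrite ?muln1 ?muln0.
(* For n = d |F| this is N/n, so cancelling [m] in [dvdU] leaves divisibility of [U n] by [d]. *)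
pose m := (#|G : F|%g %/ d)%N.
have def_m : (m * d)%N = #|G : F|%g by apply: divnK.
have m_gt0 : (0 < m)%N by rewrite divn_gt0 // dvdn_leq.
have defG : #|G| = (m * (d * #|F|))%N by rewrite mulnA def_m mulnC Lagrange.
have n_gt0 : (0 < d * #|F|)%N by rewrite muln_gt0 d_gt0 cardG_gt0.
have := dvdU (d * #|F|)%N; rewrite defG mulnK // dvdn_mull // => /(_ isT).
rewrite -def_m PoszM dvdz_mul2l -?lt0n // => dvU.
rewrite mod0z; apply/dvdz_mod0P.
rewrite [X in (_ %| X)%Z](_ : _ = U (d * #|F|)%N) //.
apply: eq_bigr => H /orbitP[x _ defH].
(* Conjugates share the order of [F], so [K : H] divides d exactly when |K| divides d |F|. *)
have cardH : #|H| = #|F| by rewrite -defH /= cardJg.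
rewrite big_mkcond [RHS]big_mkcond; apply: eq_bigr => K _ /=.
case: (K \in _) => //=; have [sHK|//] := boolP (H \subset K).
rewrite /= -(Lagrange sHK) mulnC cardH dvdn_pmul2r //.
by case: (_ %| d)%N; rewrite ?mulr1 ?mulr0.
Qed.
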